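(* Let $n,d\ge 1$ and let $X\subseteq\mathbb{C}^{n+1}$ be a set defined by homogeneous polynomial equations. Let $c:=\dim \mathcal{I}_d(X)$, let $\{f_1,\dots,f_c\}$ be a basis of $\mathcal{I}_d(X)$, and let $l_1,\dots,l_c$ be the linear functionals on $\operatorname{S}^d(\mathbb{C}^{n+1})$ such that $$l_i\Big(\sum_j (u_j)^{\otimes d}\Big)=\sum_j f_i(u_j)$$ for all finite families of vectors $u_j\in\mathbb{C}^{n+1}$. Then a tensor $\mathcal{A}\in \operatorname{S}^d(\mathbb{C}^{n+1})$ belongs to $\operatorname{S}^d(X)$ if and only if $l_1(\mathcal{A})=\cdots=l_c(\mathcal{A})=0$. Consequently, the codimension of $\operatorname{S}^d(X)$ in $\operatorname{S}^d(\mathbb{C}^{n+1})$ is $c$, i.e., $$\dim \operatorname{S}^d(X)=\binom{n+d}{d}-c.$$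
   Context: $\operatorname{S}^d(\mathbb{C}^{n+1})$ is the space of symmetric tensors of order $d$ on $\mathbb{C}^{n+1}$, i.e. arrays $(\mathcal{A}_{i_1\dots i_d})_{0\le i_1,\dots,i_d\le n}$ of complex numbers invariant under permutation of indices; $u^{\otimes d}$ is the tensor with entries $u_{i_1}\cdots u_{i_d}$. $\operatorname{S}^d(X)$ is the subspace of all $\mathcal{A}\in\operatorname{S}^d(\mathbb{C}^{n+1})$ that admit a symmetric $X$-decomposition, i.e. $\mathcal{A}=(u_1)^{\otimes d}+\cdots+(u_r)^{\otimes d}$ for some $r$ and some $u_1,\dots,u_r\in X$. $\mathcal{I}_d(X)$ is the space of all homogeneous polynomials of degree $d$ in $\mathbb{C}[x_0,\dots,x_n]$ (including $0$) that vanish identically on $X$. Explicitly, $l_i(\mathcal{A})=\sum_{\alpha} p_\alpha\mathcal{A}_\alpha$, where $f_i(1,y_1,\dots,y_n)=\sum_{\alpha\in\mathbb{N}^n,|\alpha|\le d}p_\alpha y^\alpha$ and $\mathcal{A}_\alpha:=\mathcal{A}_{j_1\dots j_d}$ whenever $x_0^{d-|\alpha|}x_1^{\alpha_1}\cdots x_n^{\alpha_n}=x_{j_1}\cdots x_{j_d}$. *)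

(* Defs.v *)
From HB Require Import structures.
From mathcomp Require Import all_boot all_order all_algebra all_fingroup.
From mathcomp Require Import complex mpoly.
From mathcomp Require Import boolp classical_sets reals.

Set Implicit Arguments.
Unset Strict Implicit.
Unset Printing Implicit Defensive.

Import GRing.Theory.
Local Open Scope ring_scope.

Section Comprehension.
Variables (K : fieldType) (V : vectType K).
Implicit Types (P : set V) (U : {vspace V}).

Definition is_subspace P :=
  P 0 /\ forall (a : K) (u v : V), P u -> P v -> P (a *: u + v).

Lemma subspace_vspace P :
  is_subspace P -> exists U, forall v, v \in U <-> P v.
Proof.
move=> [P0 Plin].
pose Q k := `[< exists U, (forall v, v \in U -> P v) /\ \dim U = k >].
have exQ : exists k, Q k.
  exists 0%N; apply/asboolP; exists 0%VS; split; last by rewrite dimv0.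
  by move=> v; rewrite memv0 => /eqP ->.
have ubQ k : Q k -> (k <= \dim {:V})%N.
  by move=> /asboolP[U [_ <-]]; rewrite dimvS ?subvf.
case: (ex_maxnP exQ ubQ) => k /asboolP[U [UP dimU]] maxk.
exists U => v; split=> [|Pv]; first exact: UP.
apply/negPn/negP => vU.
have /maxk : Q (\dim (U + <[v]>)).
  apply/asboolP; exists (U + <[v]>)%VS; split=> // w.
  case/memv_addP=> x xU [y /vlineP[a ->] ->].
  by rewrite addrC; apply: Plin => //; apply: UP.
rewrite -dimU => le_dim.
have /eqP eqU : U == (U + <[v]>)%VS by rewrite eqEdim addvSl le_dim.
by move/negP: vU; apply; rewrite eqU memvE addvSr.
Qed.

Definition vspace_of P (subP : is_subspace P) : {vspace V} :=
  projT1 (cid (subspace_vspace subP)).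

Lemma vspace_ofP P (subP : is_subspace P) v : v \in vspace_of subP <-> P v.
Proof. exact: (projT2 (cid (subspace_vspace subP)) v). Qed.

End Comprehension.

Section SymmetricTensors.
Variables (R : realType) (n d : nat).
Local Notation C := R[i].

(* The entry of index (i_1, ..., i_d) is the value at the tuple [:: i_1; ...]. *)
Definition tensor := {ffun d.-tuple 'I_n.+1 -> C^o}.

Definition permidx (s : 'S_d) (t : d.-tuple 'I_n.+1) : d.-tuple 'I_n.+1 :=
  [tuple tnth t (s k) | k < d].

Definition symmetric_tensors : set tensor :=
  [set A | forall s t, A (permidx s t) = A t].

Lemma symmetric_tensors_subspace : is_subspace symmetric_tensors.
Proof.
split=> [s t|a A B symA symB s t]; first by rewrite !ffunE.
by rewrite !ffunE symA symB.
Qed.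

Definition symtensor := subvs_of (vspace_of symmetric_tensors_subspace).

Definition tpow (u : 'rV[C]_n.+1) : tensor :=
  [ffun t : d.-tuple 'I_n.+1 => \prod_(k < d) u 0 (tnth t k)].

Lemma tpow_sym u : tpow u \in vspace_of symmetric_tensors_subspace.
Proof.
apply/vspace_ofP => s t; rewrite !ffunE.
rewrite [RHS](reindex_inj (@perm_inj _ s)) /=.
by apply: eq_bigr => k _; rewrite tnth_mktuple.
Qed.

Definition sympow (u : 'rV[C]_n.+1) : symtensor := Subvs (tpow_sym u).

Definition Sd_of (X : set 'rV[C]_n.+1) : set symtensor :=
  [set A | exists (r : nat) (u : 'I_r -> 'rV[C]_n.+1),
     (forall j, X (u j)) /\ A = \sum_(j < r) sympow (u j)].

Definition vanishing_forms (X : set 'rV[C]_n.+1) : set (dhomog n.+1 C d) :=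
  [set p | forall u, X u -> p.@[u 0] = 0].

Lemma vanishing_forms_subspace X : is_subspace (vanishing_forms X).
Proof.
split=> [u _|a p q p0 q0 u Xu] /=; first by rewrite meval0.
by rewrite mevalD mevalZ p0 // q0 // mulr0 addr0.
Qed.

Definition Id_of (X : set 'rV[C]_n.+1) : {vspace dhomog n.+1 C d} :=
  vspace_of (vanishing_forms_subspace X).

(* [A_alpha]: the common value of the entries [A (j_1, ..., j_d)] such that   *)
(* 'X_[m] = 'X_j_1 * ... * 'X_j_d; [m2s m] lists such indices when the degree *)
(* of m is d.                                                                 *)
Definition monomial_entry (m : 'X_{1..n.+1}) (A : symtensor) : C :=
  (vsval A) [tuple nth ord0 (m2s m) k | k < d].

Definition form_functional (f : dhomog n.+1 C d) (A : symtensor) : C^o :=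
  \sum_(m <- msupp f) f@_m * monomial_entry m A.

Lemma form_functional_linear f : linear (form_functional f).
Proof.
move=> a A B; rewrite /form_functional scaler_sumr -big_split /=.
apply: eq_bigr => m _; rewrite /monomial_entry linearP !ffunE /=.
by rewrite mulrDr [a *: _]mulrCA.
Qed.

HB.instance Definition _ f :=
  GRing.isLinear.Build C symtensor C^o *:%R (form_functional f)
    (form_functional_linear f).

(* So a linear functional that sends every sum of powers of vectors to the    *)
(* sum of the values of f at these vectors exists.                            *)
Lemma form_functional_sum f (r : nat) (u : 'I_r -> 'rV[C]_n.+1) :
  form_functional f (\sum_(j < r) sympow (u j)) = \sum_(j < r) f.@[u j 0].
Proof.
rewrite linear_sum; apply: eq_bigr => j _ /=; move: (u j) => {r}v {u j}.
rewrite mevalE; apply: eq_big_seq => m mf; congr (_ * _).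
have sz : size (m2s m) = d.
  rewrite size_m2s; have /dhomogP := dhomog_is_dhomog f; exact.
rewrite /monomial_entry /= ffunE.
rewrite (eq_bigr (fun k : 'I_d => v 0 (nth ord0 (m2s m) k))); last first.
  by move=> k _; rewrite tnth_mktuple.
rewrite -(big_mkord xpredT (fun k => v 0 (nth ord0 (m2s m) k))) -sz.
rewrite -(big_nth ord0 xpredT (fun i => v 0 i)) /m2s big_flatten big_map /=.
rewrite big_enum /=; apply: eq_bigr => i _.
by rewrite big_nseq -Monoid.iteropE.
Qed.

End SymmetricTensors.

Definition homog_locus (R : realType) (n : nat) (X : set 'rV[R[i]]_n.+1) :=
  exists G : set {mpoly R[i][n.+1]},
    (forall g, G g -> exists k : nat, g \is k.-homog) /\
    X = [set u | forall g, G g -> g.@[u 0] = 0]%classic.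

(* Main.v *)
(* Every linear functional h on the symmetric tensors is the functional of a  *)
(* form f of degree d, with f(u) = h(u^(x)d). If h vanishes on S^d(X), which  *)
(* is a subspace because X is a cone and C has d-th roots, then f lies in     *)
(* I_d(X). Hence S^d(X) is the common zero set of the functionals of the      *)
(* forms in I_d(X). For X the whole space, I_d(X) = 0, so powers span; thus a *)
(* form is determined by its functional, linearly independent forms have      *)
(* linearly independent functionals, and the dimensions follow from           *)
(* rank-nullity.                                                              *)

Require Import Defs.
From HB Require Import structures.
From mathcomp Require Import all_boot all_order all_algebra all_fingroup.
From mathcomp Require Import complex mpoly.
From mathcomp Require Import boolp classical_sets reals.

Set Implicit Arguments.
Unset Strict Implicit.
Unset Printing Implicit Defensive.

Import GRing.Theory.
Local Open Scope ring_scope.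

(** Evaluation pairs forms of degree [d] with symmetric tensors through [form_functional], and the
    pairing is perfect. [functional_is_form] says that forms give all functionals, so for a cone [X]
    double annihilation identifies [Sd_of X] ([Sd_ofP]). [form_vanishing_eq0] says that no nonzero
    form is lost, so powers span ([Sd_of_setT]) and independent forms cut out independent conditions
    ([dim_lker_forms_map]). *)

(** * Polynomials that vanish as functions *)

Lemma poly_vanishing_eq0 (F : numDomainType) (q : {poly F}) :
  (forall t, q.[t] = 0) -> q = 0.
Proof.
move=> q0; apply/eqP; apply: contraT => q_nz.
(* In characteristic 0 the first [size q] naturals are distinct, which is more roots than [q] can
   have. *)
have /(max_poly_roots q_nz) : all (root q) [seq i%:R | i <- iota 0 (size q)].
  by apply/allP => t _; rewrite /root q0.
rewrite map_inj_uniq ?iota_uniq; last first.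
  by move=> i j /eqP; rewrite Num.Theory.eqr_nat => /eqP.
by move=> /(_ isT); rewrite size_map size_iota ltnn.
Qed.

(** The lowest digit is the residue modulo [B]; cancel it, divide by [B] and recurse. *)
Lemma digits_inj (B n : nat) (a b : 'I_n -> nat) :
    (forall i, a i < B)%N -> (forall i, b i < B)%N ->
  (\sum_(i < n) a i * B ^ i = \sum_(i < n) b i * B ^ i)%N -> a =1 b.
Proof.
elim: n a b => [|n IHn] a b aB bB; first by move=> _ [].
have shift (c : 'I_n.+1 -> nat) : (\sum_(i < n.+1) c i * B ^ i =
    (\sum_(i < n) c (lift ord0 i) * B ^ i) * B + c ord0)%N.
  rewrite big_ord_recl expn0 muln1 addnC big_distrl /=; congr (_ + _)%N.
  by apply: eq_bigr => i _; rewrite /bump /= add1n expnSr mulnA.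
rewrite !shift => eq_ab.
have B0 : (0 < B)%N by exact: leq_ltn_trans (aB ord0).
have eq0 : a ord0 = b ord0.
  by move/(congr1 (modn^~ B)): eq_ab; rewrite !modnMDl !modn_small.
move: eq_ab; rewrite eq0 => /addIn /eqP; rewrite eqn_pmul2r // => /eqP eqS.
move=> i; case: (unliftP ord0 i) => [j ->|-> //].
by apply: (IHn (a \o lift ord0) (b \o lift ord0)) => // k; [apply: aB | apply: bB].
Qed.

(* Kronecker substitution [x_i := t ^ (B ^ i)], with B larger than all the    *)
(* exponents, reduces the claim to the univariate case.                       *)
Lemma mpoly_vanishing_eq0 (F : numDomainType) (n : nat) (p : {mpoly F[n]}) :
  (forall v, p.@[v] = 0) -> p = 0.
Proof.
move=> p0; pose B := msize p.
pose e (m : 'X_{1..n}) := (\sum_(i < n) m i * B ^ i)%N.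
have e_inj : {in msupp p &, injective e}.
  have expB m i : m \in msupp p -> (m i < B)%N.
    move=> mp; apply: leq_ltn_trans (msize_mdeg_lt mp).
    by rewrite mdegE (bigD1 i) //= leq_addr.
  move=> m1 m2 m1p m2p /digits_inj eq12; apply/mnmP => i.
  by apply: eq12 => j; apply: expB.
pose q : {poly F} := \sum_(m <- msupp p) p@_m *: 'X^(e m).
have q0 : q = 0.
  apply: poly_vanishing_eq0 => t; rewrite -[RHS](p0 (fun i => t ^+ (B ^ i))).
  rewrite mevalE horner_sum; apply: eq_bigr => m _.
  rewrite hornerZ hornerXn -prodrXr; congr (_ * _).
  by apply: eq_bigr => i _; rewrite -exprM mulnC.
apply/mpolyP => m; rewrite mcoeff0.
have [mp|] := boolP (m \in msupp p); last exact: memN_msupp_eq0.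
(* Distinct monomials yield distinct powers, so the coefficient of [q] at [e m] is [p@_m]. *)
rewrite -[RHS](coef0 _ (e m)) -q0 coef_sum (bigD1_seq m) //=.
rewrite coefZ coefXn eqxx mulr1 big_seq_cond big1 ?addr0 // => k /andP[kp km].
by rewrite coefZ coefXn (inj_in_eq e_inj) // eq_sym (negPf km) mulr0.
Qed.

(** * Supports, index lists and separation *)

Lemma msupp_sum_subset (F : nzRingType) (n : nat) (p : {mpoly F[n]})
    (r : seq 'X_{1..n}) (h : 'X_{1..n} -> F) :
    uniq r -> {subset msupp p <= r} ->
  \sum_(m <- msupp p) p@_m * h m = \sum_(m <- r) p@_m * h m.
Proof.
move=> r_uniq sub; rewrite [RHS](bigID (mem (msupp p))) /= [X in _ = _ + X]big1 ?addr0.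
  rewrite -[RHS]big_filter; apply: perm_big; apply: uniq_perm => //.
    exact: filter_uniq.
  by move=> m; rewrite mem_filter andb_idr //; apply: sub.
by move=> m mp; rewrite memN_msupp_eq0 ?mul0r.
Qed.

Lemma perm_m2s_s2m (n : nat) (s : seq 'I_n) : perm_eq s (m2s (s2m s)).
Proof.
apply/allP => i _ /=; apply/eqP.
by have /mnmP/(_ i) := s2mK (s2m s); rewrite !mnmE.
Qed.

Lemma separating_functional (K : fieldType) (V : vectType K) (U : {vspace V}) v :
    v \notin U ->
  exists2 h : 'Hom(V, K^o), (forall u, u \in U -> h u = 0) & h v != 0.
Proof.
(* The part of [v] off [U] is nonzero, so one of its coordinates is; that coordinate of the off-[U]
   part is the functional. *)
move=> vU; pose w := v - projv U v.
have w_nz : w != 0.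
  by apply: contraNneq vU => /eqP; rewrite subr_eq0 => /eqP ->; apply: memv_proj.
have [i wi] : exists i, coord (vbasis fullv) i w != 0.
  apply/existsP; apply: contraNT w_nz; rewrite negb_exists => /forallP w0.
  rewrite (coord_vbasis (memvf w)) big1 // => i _.
  by have := w0 i; rewrite negbK => /eqP ->; rewrite scale0r.
pose cw : V -> K^o := coord (vbasis fullv) i.
exists (linfun cw \o (\1 - projv U))%VF => [u uU|];
  rewrite comp_lfunE lfunE !lfun_simp /=.
  by rewrite projv_id // subrr linear0.
by [].
Qed.

Section Duality.
Variables (R : realType) (n d : nat).
Local Notation C := R[i].
Implicit Types (A : symtensor R n d) (f : dhomog n.+1 C d) (X : set 'rV[C]_n.+1).

(** * Functionals on symmetric tensors are forms *)

Lemma form_functional_sympow f (u : 'rV[C]_n.+1) :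
  form_functional f (sympow d u) = f.@[u 0].
Proof.
have := form_functional_sum f (fun _ : 'I_1 => u).
by rewrite !big_ord1.
Qed.

Lemma symtensor_entry A (t : d.-tuple 'I_n.+1) :
  vsval A t = monomial_entry (s2m t) A.
Proof.
have /vspace_ofP symA : vsval A \in vspace_of (symmetric_tensors_subspace R n d).
  exact: subvsP.
have p_t := perm_m2s_s2m t.
have sz : size (m2s (s2m t)) == d by rewrite -(perm_size p_t) size_tuple.
have /tuple_permP[s def_s] : perm_eq (m2s (s2m t)) t by rewrite perm_sym.
rewrite /monomial_entry -(symA s t); congr (vsval A _).
apply: eq_from_tnth => k; rewrite !tnth_mktuple def_s.
by rewrite -tnth_nth tnth_mktuple.
Qed.

(* The form of a functional h has as coefficients the values of h on the      *)
(* symmetrizations of the elementary tensors.                                 *)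
Lemma functional_is_form (h : 'Hom(symtensor R n d, C^o)) :
  exists f, forall A, h A = form_functional f A.
Proof.
pose S := vspace_of (symmetric_tensors_subspace R n d).
pose E (t : d.-tuple 'I_n.+1) : tensor R n d := [ffun s => (s == t)%:R].
pose a t : C := h (vsproj S (E t)).
pose p : {mpoly C[n.+1]} := \sum_(t : d.-tuple 'I_n.+1) a t *: 'X_[s2m t].
have p_homog : p \is d.-homog.
  apply: rpred_sum => t _; apply: rpredZ; rewrite dhomogX /=.
  by rewrite -size_m2s -(perm_size (perm_m2s_s2m t)) size_tuple.
exists (DHomog p_homog) => A.
(* A fixed list containing the support of [p], so that the sums over monomials and over tuples can
   be exchanged. *)
pose r := undup [seq s2m (val t) | t : d.-tuple 'I_n.+1].
have mem_r (t : d.-tuple 'I_n.+1) : s2m t \in r.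
  by rewrite mem_undup; apply: map_f; rewrite mem_enum.
have coef_p m : p@_m = \sum_(t : d.-tuple 'I_n.+1) a t * (s2m t == m)%:R.
  by rewrite raddf_sum; apply: eq_bigr => t _ /=; rewrite mcoeffZ mcoeffX.
rewrite /form_functional (@msupp_sum_subset _ _ _ r) ?undup_uniq //=; last first.
  move=> m; rewrite mcoeff_msupp coef_p; apply: contraNT => m_r.
  rewrite big1 // => t _; case: eqP => [tm|_]; last by rewrite mulr0.
  by rewrite -tm mem_r in m_r.
under eq_bigr => m _ do rewrite coef_p mulr_suml.
rewrite exchange_big /=.
have scaleE (k : C) t s : (k *: E t) s = k * (s == t)%:R by rewrite !ffunE.
(* Expand [A] in elementary tensors and project: [vsproj S] is linear and fixes symmetric
   tensors. *)
have defA : A = \sum_(t : d.-tuple 'I_n.+1) vsval A t *: vsproj S (E t).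
  rewrite -[LHS]vsvalK.
  have {1}-> : vsval A = \sum_(t : d.-tuple 'I_n.+1) vsval A t *: E t.
    apply/ffunP => s; rewrite sum_ffunE (bigD1 s) //= big1 => [|t ts].
      by rewrite addr0 scaleE eqxx mulr1.
    by rewrite scaleE eq_sym (negPf ts) mulr0.
  by rewrite linear_sum; apply: eq_bigr => t _; rewrite linearZ.
rewrite [in LHS]defA linear_sum; apply: eq_bigr => t _.
rewrite linearZ /= (bigD1_seq (s2m t)) ?undup_uniq //= eqxx mulr1.
rewrite big1 ?addr0; first by rewrite -symtensor_entry mulrC.
by move=> m mt; rewrite eq_sym (negPf mt) mulr0 mul0r.
Qed.

(** * Sums of powers from a cone *)

Lemma sympowZ (a : C) (u : 'rV[C]_n.+1) :
  sympow d (a *: u) = a ^+ d *: sympow d u.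
Proof.
apply: (can_inj (@vsvalK _ _ _)); rewrite linearZ /=.
apply/ffunP => t; rewrite !ffunE.
under eq_bigr => k _ do rewrite mxE.
by rewrite big_split prodr_const card_ord.
Qed.

Definition is_cone X := forall (a : C) u, X u -> X (a *: u).

Lemma Sd_of_cone_subspace X : (0 < d)%N -> is_cone X ->
  is_subspace (Sd_of X : set (symtensor R n d)).
Proof.
move=> d_gt0 coneX; split.
  exists 0%N, (fun _ => 0); split; first by case.
  by rewrite big_ord0.
move=> a _ _ [r [u [Xu ->]]] [s [v [Xv ->]]].
(* A scalar is absorbed into the vectors as its [d]-th root; this is where [0 < d] matters. *)
pose b := Num.Theory.nthroot d a.
exists (r + s)%N.
exists (fun j => match split j with inl i => b *: u i | inr i => v i end).
split=> [j|]; first by case: (split j) => i; [apply: coneX | apply: Xv].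
rewrite big_split_ord scaler_sumr /=; congr (_ + _); apply: eq_bigr => i _.
  by rewrite (unsplitK (inl i)) sympowZ Num.Theory.rootCK.
by rewrite (unsplitK (inr i)).
Qed.

Lemma Sd_ofP X A : (0 < d)%N -> is_cone X ->
  Sd_of X A <-> forall f, f \in Id_of d X -> form_functional f A = 0.
Proof.
move=> d_gt0 coneX; split=> [[r [u [Xu ->]]] f /vspace_ofP fX|A0].
  by rewrite form_functional_sum big1 // => j _; apply: fX.
pose subX := Sd_of_cone_subspace d_gt0 coneX.
apply/(vspace_ofP subX); apply: contraT => A_notin.
have [h hX /eqP[]] := separating_functional A_notin.
(* The separating functional is a form [f]; it kills powers of points of [X], so [f] lies in
   [Id_of d X]. *)
have [f hf] := functional_is_form h; rewrite hf; apply: A0.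
apply/vspace_ofP => u Xu; rewrite -form_functional_sympow -hf.
apply: hX; apply/vspace_ofP; exists 1%N, (fun _ => u); split=> //.
by rewrite big_ord1.
Qed.

Lemma homog_locus_cone X : homog_locus X -> is_cone X.
Proof.
move=> [G [homG ->]] a u /= u0 g Gg; have [k gk] := homG g Gg.
suff -> : g.@[(a *: u) 0] = a ^+ k * g.@[u 0] by rewrite u0 ?mulr0.
rewrite !mevalE mulr_sumr; apply: eq_big_seq => m mg.
rewrite mulrCA; congr (_ * _).
rewrite -(dhomog_mf gk mg) /= mdegE -prodrXr -big_split /=.
by apply: eq_bigr => i _; rewrite mxE exprMn.
Qed.

Lemma form_vanishing_eq0 f : (forall u : 'rV[C]_n.+1, f.@[u 0] = 0) -> f = 0.
Proof.
move=> f0; apply/val_inj/mpoly_vanishing_eq0 => v.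
rewrite -[RHS](f0 (\row_i v i)); apply: meval_eq => i.
by rewrite mxE.
Qed.

Lemma Sd_of_setT A : (0 < d)%N -> Sd_of setT A.
Proof.
move=> d_gt0; apply/Sd_ofP => // f /vspace_ofP f0.
rewrite (@form_vanishing_eq0 f) => [|u]; last exact: f0.
by rewrite /form_functional msupp0 big_nil.
Qed.

(** The sum defining [form_functional] runs over the support of the form, which hides linearity in
    the form; on sums of powers it is linearity of evaluation. *)
Lemma form_functional_sumZ (c : nat) (k : 'I_c -> C)
    (f : 'I_c -> dhomog n.+1 C d) A : (0 < d)%N ->
  form_functional (\sum_(i < c) k i *: f i) A =
  \sum_(i < c) k i * form_functional (f i) A.
Proof.
move=> d_gt0; have [r [u [_ ->]]] := Sd_of_setT A d_gt0.
rewrite form_functional_sum.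
under [RHS]eq_bigr => i _ do rewrite form_functional_sum mulr_sumr.
rewrite [RHS]exchange_big /=. apply: eq_bigr => j _ /=.
rewrite linear_sum raddf_sum; apply: eq_bigr => i _ /=.
by rewrite mevalZ.
Qed.

(** * Dimension count *)

Definition forms_map (c : nat) (f : c.-tuple (dhomog n.+1 C d)) A : 'rV[C]_c :=
  \row_i form_functional (tnth f i) A.

Lemma forms_map_linear (c : nat) (f : c.-tuple (dhomog n.+1 C d)) :
  linear (forms_map f).
Proof. by move=> a A B; apply/rowP => i; rewrite !mxE linearP. Qed.

HB.instance Definition _ (c : nat) (f : c.-tuple (dhomog n.+1 C d)) :=
  GRing.isLinear.Build C (symtensor R n d) 'rV[C]_c *:%R (forms_map f)
    (forms_map_linear f).

Lemma mem_lker_forms_map (c : nat) (f : c.-tuple (dhomog n.+1 C d)) A :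
  (A \in lker (linfun (forms_map f))) <->
  (forall i, form_functional (tnth f i) A = 0).
Proof.
rewrite memv_ker lfunE /=; split=> [/eqP/rowP A0 i|A0].
  by have := A0 i; rewrite !mxE.
by apply/eqP/rowP => i; rewrite !mxE.
Qed.

(** By rank-nullity it suffices that the map is onto. A functional killing its image has
    coefficients [k i] for which the combination of the forms vanishes at every [u]; freeness gives
    [k i = 0]. *)
Lemma dim_lker_forms_map (c : nat) (f : c.-tuple (dhomog n.+1 C d)) :
    (0 < d)%N -> free f ->
  (\dim (lker (linfun (forms_map f))) + c)%N = \dim {:symtensor R n d}.
Proof.
move=> d_gt0 /freeP free_f.
rewrite -(limg_ker_dim (linfun (forms_map f)) fullv) capfv; congr (_ + _)%N.
suff -> : limg (linfun (forms_map f)) = fullv.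
  by rewrite dimvf dim_matrix mul1r.
apply/vspaceP => w; rewrite memvf; apply: contraT => w_notin.
have [h h0 /eqP[]] := separating_functional w_notin.
pose k i : C := h (delta_mx 0 i).
have hE v : h v = \sum_i v 0 i * k i.
  rewrite {1}[v]row_sum_delta linear_sum; apply: eq_bigr => i _.
  by rewrite linearZ.
have k0 : forall i, k i = 0.
  apply: free_f; apply: form_vanishing_eq0 => u.
  under eq_bigr => i _ do rewrite -tnth_nth.
  rewrite -form_functional_sympow form_functional_sumZ //.
  have := h0 _ (memv_img (linfun (forms_map f)) (memvf (sympow d u))).
  rewrite hE => {2}<-; apply: eq_bigr => i _.
  by rewrite lfunE mxE mulrC.
by rewrite hE big1 // => i _; rewrite k0 mulr0.
Qed.

(** For a basis of all forms the kernel is zero, since every functional is a form and functionals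
    separate tensors. *)
Lemma dim_symtensor : (0 < d)%N -> \dim {:symtensor R n d} = 'C(n + d, d).
Proof.
move=> d_gt0; pose f := vbasis {: dhomog n.+1 C d}.
have free_f : free f by apply: basis_free (vbasisP _).
have dim_forms : \dim {: dhomog n.+1 C d} = 'C(n + d, d).
  by rewrite dimvf addnC.
have := dim_lker_forms_map d_gt0 free_f.
suff -> : lker (linfun (forms_map f)) = 0%VS by rewrite dimv0 add0n dim_forms => <-.
apply/eqP; rewrite -subv0; apply/subvP => A /mem_lker_forms_map A0.
apply: contraT => A_notin.
have [h _ /eqP[]] := separating_functional A_notin.
have [g ->] := functional_is_form h.
rewrite (coord_vbasis (memvf g)) form_functional_sumZ // big1 // => i _.
by have := A0 i; rewrite (tnth_nth 0) => ->; rewrite mulr0.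
Qed.

End Duality.

Theorem proposition3p1 (R : realType) (n d : nat) (hn : (1 <= n)%N)
    (hd : (1 <= d)%N)
    (X : set 'rV[R[i]]_n.+1) (hX : homog_locus X)
    (c : nat) (hc : c = \dim (Id_of d X))
    (f : c.-tuple (dhomog n.+1 R[i] d)) (hf : basis_of (Id_of d X) f)
    (l : 'I_c -> {linear symtensor R n d -> R[i]^o})
    (hl : forall (i : 'I_c) (r : nat) (u : 'I_r -> 'rV[R[i]]_n.+1),
       l i (\sum_(j < r) sympow d (u j)) = \sum_(j < r) (tnth f i).@[u j 0]) :
  (forall A : symtensor R n d, Sd_of X A <-> forall i : 'I_c, l i A = 0) /\
  (exists2 U : {vspace symtensor R n d},
     (forall A : symtensor R n d, A \in U <-> Sd_of X A) &
     (\dim {:symtensor R n d} - \dim U)%N = c /\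
     (\dim U)%:Z = ('C(n + d, d))%:Z - c%:Z).
Proof.
(* Every tensor is a sum of powers, so [hl] determines [l i]. *)
have lE i A : l i A = form_functional (tnth f i) A.
  have [r [u [_ ->]]] := Sd_of_setT A hd.
  by rewrite hl form_functional_sum.
have SdP A : Sd_of X A <-> forall i, form_functional (tnth f i) A = 0.
  rewrite (Sd_ofP A hd (homog_locus_cone hX)); split=> [A0 i|A0 g gX].
    by apply: A0; apply: (basis_mem hf); apply: mem_tnth.
  rewrite (coord_basis hf gX).
  under eq_bigr => i _ do rewrite -tnth_nth.
  by rewrite form_functional_sumZ // big1 // => i _; rewrite A0 mulr0.
split=> [A|]; first by rewrite SdP; split=> A0 i; have := A0 i; rewrite lE.
exists (lker (linfun (forms_map f))) => [A|].
  by rewrite mem_lker_forms_map SdP.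
have := dim_lker_forms_map hd (basis_free hf); rewrite dim_symtensor // => <-.
by rewrite addKn PoszD addrK.
Qed.
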